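(* Let $q=2^m>4$ (with $m$ a positive integer) and let $E$ be a supersingular elliptic curve over $\mathbf{F}_q$. The number of curves in the family $$Y^2+Y=\lambda X+\mu X^3\qquad(\lambda\in\mathbf{F}_q,\ \mu\in\mathbf{F}_q^* )$$ that are isomorphic over $\mathbf{F}_q$ to $E$ (that is, the number of pairs $(\lambda,\mu)\in\mathbf{F}_q\times\mathbf{F}_q^*$ for which the corresponding curve is isomorphic to $E$ over $\mathbf{F}_q$) is equal to $$\frac{(q-1)\,(\#E(\mathbf{F}_q)-1)}{\#\mathrm{Aut}_{\mathbf{F}_q}(E)}.$$
   Context: The equation $Y^2+Y=\lambda X+\mu X^3$ with $\mu\neq 0$ stands for the associated smooth projective curve of genus $1$, viewed as an elliptic curve over $\mathbf{F}_q$ with the point at infinity as origin. $\mathrm{Aut}_{\mathbf{F}_q}(E)$ is the group of automorphisms of the elliptic curve $E$ (fixing the origin) defined over $\mathbf{F}_q$. An elliptic curve over a field of characteristic $2$ is supersingular if it has no points of order $2$ over the algebraic closure. *)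

(* Defs.v *)
From HB Require Import structures.
From mathcomp Require Import all_boot all_order all_algebra.
From mathcomp Require Import finmap mpoly.
From mathcomp Require Import boolp classical_sets functions cardinality.

Set Implicit Arguments.
Unset Strict Implicit.
Unset Printing Implicit Defensive.

Import GRing.Theory.
Local Open Scope ring_scope.

(* The plane cubic  y^2 + a1 x y + a3 y = a0 x^3 + a2 x^2 + a4 x + a6.
   The coefficient a0 of x^3 is kept, so that nonmonic equations need not be
   rescaled; a0 = 1 gives the usual Weierstrass equations. *)
Record cubic (k : Type) := Cubic { a0 : k; a1 : k; a2 : k; a3 : k; a4 : k; a6 : k }.

Definition map_cubic (k k' : Type) (f : k -> k') (E : cubic k) : cubic k' :=
  Cubic (f (a0 E)) (f (a1 E)) (f (a2 E)) (f (a3 E)) (f (a4 E)) (f (a6 E)).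

Section Points.
Variable k : fieldType.
Implicit Type E : cubic k.

(* [Some (x, y)] is the projective point (x : y : 1) and [None] is (0 : 1 : 0),
   the only point at infinity of the projective closure when a0 != 0. *)
Definition on_cubic E (P : option (k * k)) : bool :=
  if P is Some (x, y) then
    y ^+ 2 + a1 E * x * y + a3 E * y
      == a0 E * x ^+ 3 + a2 E * x ^+ 2 + a4 E * x + a6 E
  else true.

Definition pts E := {P : option (k * k) | on_cubic E P}.

Definition origin E : pts E := exist _ None isT.

Definition hcoord (P : option (k * k)) : 3.-tuple k :=
  if P is Some (x, y) then [tuple x; y; 1] else [tuple 0; 1; 0].

(* The chord-and-tangent group law with identity [None]. *)
Definition ec_add E (P Q : option (k * k)) : option (k * k) :=
  match P, Q with
  | None, _ => Q
  | _, None => P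
  | Some (x1, y1), Some (x2, y2) =>
    if (x1 == x2) && (y1 == - y2 - a1 E * x2 - a3 E) then None else
    let l :=
      if x1 == x2 then
        (a0 E * x1 ^+ 2 *+ 3 + a2 E * x1 *+ 2 + a4 E - a1 E * y1)
          / (y1 *+ 2 + a1 E * x1 + a3 E)
      else (y2 - y1) / (x2 - x1) in
    let x := (l ^+ 2 + a1 E * l - a2 E) / a0 E - x1 - x2 in
    let y := l * (x - x1) + y1 in
    Some (x, - y - a1 E * x - a3 E)
  end.

Definition order2 E (P : pts E) : Prop :=
  P <> origin E /\ ec_add E (val P) (val P) = None.

End Points.

Section Curves.
(* K is meant to be an algebraic closure of F, with embedding iota. *)
Variables (F K : fieldType) (iota : {rmorphism F -> K}).
Implicit Types E C : cubic F.

Definition gpts E := pts (map_cubic iota E).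

(* The point at infinity is always smooth when a0 != 0, so the partial
   derivatives are only required not to vanish together at affine points. *)
Definition elliptic E : Prop :=
  a0 E != 0 /\
  forall x y : K, let EK := map_cubic iota E in
    on_cubic EK (Some (x, y)) ->
    ~ (a1 EK * y = a0 EK * x ^+ 2 *+ 3 + a2 EK * x *+ 2 + a4 EK
       /\ y *+ 2 + a1 EK * x + a3 EK = 0).

Definition supersingular E : Prop := forall P : gpts E, ~ order2 P.

Definition form_at (G : {mpoly F[3]}) (P : option (K * K)) : K :=
  mmap iota (tnth (hcoord P)) G.

(* Morphisms over F of the projective curves, as maps on K-points: around each
   point the map is given by three forms over F of the same degree, not all
   zero at that point, wherever these do not vanish together. *)
Definition regular_map E C (f : gpts E -> gpts C) : Prop :=
  forall P : gpts E, exists d, exists G : 'I_3 -> {mpoly F[3]},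
    [/\ forall i, G i \is d.-homog,
        exists i, form_at (G i) (val P) != 0
      & forall Q : gpts E, (exists i, form_at (G i) (val Q) != 0) ->
          exists2 c : K, c != 0 &
            forall i, form_at (G i) (val Q) = c * tnth (hcoord (val (f Q))) i].

Definition ec_iso E C (f : gpts E -> gpts C) : Prop :=
  [/\ regular_map f,
      f (origin _) = origin _
    & exists g : gpts C -> gpts E,
        [/\ regular_map g, cancel f g & cancel g f]].

Definition isomorphic E C : Prop := exists f : gpts E -> gpts C, ec_iso f.

Definition ec_aut E : set (gpts E -> gpts E) := [set f | ec_iso f].

End Curves.

Arguments ec_aut {F K} iota E _.

(* Y^2 + Y = lambda X + mu X^3 *)
Definition family_curve (F : fieldType) (lambda mu : F) : cubic F :=
  Cubic mu 0 0 1 lambda 0.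

(* Main.v *)
(** In characteristic 2 a smooth cubic with a0 <> 0 is supersingular exactly
    when a1 = 0 and a3 <> 0, and then two distinct points lie above each x.  Taking
    norms of denominators, a function given locally by quotients of forms is
    p(x) + q(x) y with p and q over F.  Comparing orders of poles at infinity
    for an isomorphism and its inverse, every isomorphism between such curves
    is a substitution (u x + r, v y + s x + t) over F.
    Substituting in E, the result is proportional to Y^2 + Y = lam X + mu X^3
    iff v = a3, (r, t) is a point of E and s^2 = u^2 (a0 r + a2); as squaring is
    bijective on F, the isomorphisms from members of the family to E are
    parametrized by u <> 0 and the affine point (r, t).  The isomorphisms from
    one given member, when there are any, form a torsor under Aut(E). *)

Require Import Defs.
From HB Require Import structures.
From mathcomp Require Import all_boot all_order all_algebra all_field.
From mathcomp Require Import finmap mpoly zify ring.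
From mathcomp Require Import boolp classical_sets functions cardinality.

Set Implicit Arguments.
Unset Strict Implicit.
Unset Printing Implicit Defensive.

Import GRing.Theory.
Local Open Scope ring_scope.

(** * Polynomials over [F] evaluated in the algebraically closed field [K] *)

Section Evaluation.
Variables (F : fieldType) (K : closedFieldType) (iota : {rmorphism F -> K}).
Implicit Types (p q : {poly F}) (x : K).

Definition ev p x := (map_poly iota p).[x].

Lemma evD p q x : ev (p + q) x = ev p x + ev q x.
Proof. by rewrite /ev rmorphD hornerD. Qed.

Lemma evN p x : ev (- p) x = - ev p x.
Proof. by rewrite /ev rmorphN hornerN. Qed.

Lemma evM p q x : ev (p * q) x = ev p x * ev q x.
Proof. by rewrite /ev rmorphM hornerM. Qed.

Lemma evXn p n x : ev (p ^+ n) x = ev p x ^+ n.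
Proof. by rewrite /ev rmorphXn horner_exp. Qed.

Lemma evC c x : ev c%:P x = iota c.
Proof. by rewrite /ev map_polyC hornerC. Qed.

Lemma evX x : ev 'X x = x.
Proof. by rewrite /ev map_polyX hornerX. Qed.

Lemma ev0 x : ev 0 x = 0.
Proof. by rewrite /ev rmorph0 horner0. Qed.

Definition evE := (evD, evN, evM, evXn, evC, evX, ev0).

Lemma ev_root p : size p != 1%N -> exists x, ev p x = 0.
Proof.
move=> sp; have /closed_rootP[x /rootP px] : size (map_poly iota p) != 1%N.
  by rewrite size_map_poly.
by exists x.
Qed.

(** As [p] vanishes on [K], [p - 1] has no root there and is a constant; so [p] is a constant, equal
    to its value 0. *)
Lemma ev_eq0 p : (forall x, ev p x = 0) -> p = 0.
Proof.
move=> p0; have [/size_poly1P[c _ pc]|/ev_root[x]] := boolP (size (p - 1) == 1%N).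
  have pE : p = (c + 1)%:P by rewrite polyCD -pc subrK.
  by have := p0 0; rewrite pE evC => /eqP; rewrite fmorph_eq0 => /eqP->.
by rewrite evD evN p0 evC rmorph1 sub0r => /eqP; rewrite oppr_eq0 oner_eq0.
Qed.

End Evaluation.

Lemma quadratic_root (K : closedFieldType) (b c : K) :
  exists y, y ^+ 2 + b * y = c.
Proof.
pose p : {poly K} := 'X^2 + (b%:P * 'X - c%:P).
have /closed_rootP[y /rootP] : size p != 1%N.
  rewrite size_polyDl size_polyXn // (leq_ltn_trans (size_polyD _ _)) //.
  rewrite gtn_max size_polyN (leq_ltn_trans (size_polyC_leq1 _)) //.
  by rewrite mul_polyC (leq_ltn_trans (size_scale_leq _ _)) ?size_polyX.
rewrite !hornerD hornerN hornerXn hornerM hornerX !hornerC => py.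
exists y; apply/eqP.
by rewrite -subr_eq0; apply/eqP; rewrite -[RHS]py; ring.
Qed.

(** * The coordinate ring of y^2 + b y = r(x) *)

Section CoordinateRing.
Variables (F : fieldType) (K : closedFieldType) (iota : {rmorphism F -> K}).
Variables (b : F) (r : {poly F}).
Hypotheses (char2 : 2%N \in [pchar F]) (b_neq0 : b != 0) (size_r : size r = 4%N).
Implicit Types (f g h : {poly F} * {poly F}) (phi psi : K -> K -> K).

Local Notation ev := (ev iota).

Definition on x y := y ^+ 2 + iota b * y == ev r x.

Lemma on_eq x y : on x y -> y ^+ 2 = ev r x - iota b * y.
Proof. by move=> /eqP<-; rewrite addrK. Qed.

Lemma on_conj x y : on x (- y - iota b) = on x y.
Proof. by rewrite /on; congr (_ == _); ring. Qed.

(** In characteristic 2 the difference of the two sides is [- iota b]. *)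
Lemma conj_neq (y : K) : - y - iota b != y.
Proof.
have /andP[_ /eqP two0] := char2.
rewrite -subr_eq0 [X in X != 0](_ : _ = - iota b - iota 2%:R * y); last first.
  by rewrite rmorph_nat; ring.
by rewrite two0 rmorph0 mul0r subr0 oppr_eq0 fmorph_eq0.
Qed.

Lemma exists_on x : exists y, on x y.
Proof.
have [y] := quadratic_root (iota b) (ev r x).
by exists y; apply/eqP.
Qed.

(** The pair [f] stands for [f.1 + f.2 * y]; this is the product reduced by y^2 = r - b y. *)
Definition cmul f g : {poly F} * {poly F} :=
  (f.1 * g.1 + f.2 * g.2 * r,
   f.1 * g.2 + f.2 * g.1 - b%:P * (f.2 * g.2)).

Definition cconj f : {poly F} * {poly F} := (f.1 - b%:P * f.2, - f.2).

(** The product of [f] with its conjugate under y -> - y - b, a polynomial in x alone. *)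
Definition cnorm f : {poly F} :=
  f.1 ^+ 2 - b%:P * f.1 * f.2 - f.2 ^+ 2 * r.

Definition represents f phi :=
  forall x y, on x y -> phi x y = ev f.1 x + ev f.2 x * y.

Definition regular phi := exists f, represents f phi.

Lemma representsD f g phi psi : represents f phi -> represents g psi ->
  represents (f.1 + g.1, f.2 + g.2) (fun x y => phi x y + psi x y).
Proof. by move=> hf hg x y xy; rewrite hf // hg // !evE; ring. Qed.

Lemma representsM f g phi psi : represents f phi -> represents g psi ->
  represents (cmul f g) (fun x y => phi x y * psi x y).
Proof.
move=> hf hg x y xy; rewrite hf // hg // !evE.
transitivity (ev f.1 x * ev g.1 x + (ev f.1 x * ev g.2 x + ev f.2 x * ev g.1 x) * y
   + ev f.2 x * ev g.2 x * y ^+ 2); first by ring.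
by rewrite (on_eq xy); ring.
Qed.

Lemma represents_conj f phi : represents f phi ->
  represents (cconj f) (fun x y => phi x (- y - iota b)).
Proof. by move=> hf x y xy; rewrite hf ?on_conj //= !evE; ring. Qed.

Lemma ev_cnorm f phi x y : represents f phi -> on x y ->
  ev (cnorm f) x = phi x y * phi x (- y - iota b).
Proof.
move=> hf xy; rewrite !hf ?on_conj // !evE.
have -> : ev r x = y ^+ 2 + iota b * y by rewrite (on_eq xy) subrK.
ring.
Qed.

(** At each x the difference is affine in y and vanishes at two distinct values of y, so both its
    coefficients vanish there. *)
Lemma represents_inj f g phi : represents f phi -> represents g phi -> f = g.
Proof.
move=> hf hg; suff /all_and2[h1 h2] x :
    ev (f.1 - g.1) x = 0 /\ ev (f.2 - g.2) x = 0.
  case: f g hf hg h1 h2 => [f1 f2] [g1 g2] /= _ _ h1 h2.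
  by rewrite -(subrK g1 f1) (ev_eq0 h1) -(subrK g2 f2) (ev_eq0 h2) !add0r.
have e z : on x z -> ev (f.1 - g.1) x + ev (f.2 - g.2) x * z = 0.
  move=> xz; transitivity (phi x z - phi x z); last by rewrite subrr.
  by rewrite {1}(hf _ _ xz) (hg _ _ xz) !evE; ring.
have [y xy] := exists_on x.
have : ev (f.2 - g.2) x * (- y - iota b - y) = 0.
  set z := - y - _; have xz : on x z by rewrite on_conj.
  transitivity ((ev (f.1 - g.1) x + ev (f.2 - g.2) x * z)
    - (ev (f.1 - g.1) x + ev (f.2 - g.2) x * y)); first by ring.
  by rewrite !e // subrr.
move/eqP; rewrite mulf_eq0 subr_eq0 (negbTE (conj_neq y)) orbF => /eqP e2.
by split=> //; move: (e _ xy); rewrite e2 mul0r addr0.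
Qed.

(** * Pole orders at infinity *)

Lemma cnormM f g : cnorm (cmul f g) = cnorm f * cnorm g.
Proof. by rewrite /cnorm /cmul /=; ring. Qed.

(* [size (cnorm f)] is one plus the order of the pole of [f] at infinity. *)
Lemma size_cnorm f : size (cnorm f) =
  maxn (size f.1).*2.-1 (if f.2 == 0 then 0%N else (size f.2).*2.+2).
Proof.
have size_sqr (p : {poly F}) : size (p ^+ 2) = (size p).*2.-1.
  have [->|p0] := eqVneq p 0; first by rewrite expr0n size_poly0.
  by rewrite expr2 size_mul // addnn.
case: f => p q; rewrite /cnorm /=; have [->|q0] := eqVneq q 0.
  by rewrite mulr0 expr0n mul0r !subr0 size_sqr maxn0.
have r0 : r != 0 by rewrite -size_poly_eq0 size_r.
have sqr : size (q ^+ 2 * r) = (size q).*2.+2.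
  rewrite size_mul ?expf_neq0 // size_sqr size_r.
  by move: q0; rewrite -size_poly_gt0; lia.
(* The cross term is smaller than the larger of the two square terms, and these cannot cancel: one
   size is odd or 0, the other even and positive. *)
have spq : ((size (b%:P * p * q)%R).*2 < (size p).*2.-1 + (size q).*2.+2)%N.
  rewrite -mulrA mul_polyC size_scale //; have := size_polyMleq p q.
  have [->|p0] := eqVneq p 0; first by rewrite mul0r !size_poly0; lia.
  move: q0 p0; rewrite -!size_poly_gt0.
  by move: (size p) (size q) (size (p * q)) => x y z; lia.
have [lt|ge] := ltnP (size p).*2.-1 (size q).*2.+2.
  rewrite addrC size_polyDl size_polyN sqr //.
  rewrite (leq_ltn_trans (size_polyD _ _)) // gtn_max size_sqr lt size_polyN.
  by move: (size p) (size q) (size (_ * _ * q)) spq lt => x y z; lia.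
rewrite -addrA size_polyDl size_sqr //.
rewrite (leq_ltn_trans (size_polyD _ _)) // gtn_max !size_polyN sqr.
by move: (size p) (size q) (size (_ * _ * q)) spq ge => x y z; lia.
Qed.

(** A nonzero coefficient of y gives a pole of order at least 3, a nonconstant polynomial in x one
    of order at least 2. *)
Lemma size_cnorm_le1 f : (size (cnorm f) <= 1)%N -> exists c, f = (c%:P, 0).
Proof.
rewrite size_cnorm geq_max; case: f => p q /=.
case: (q =P 0) => [-> /andP[sp _]|_ /andP[_ //]]; exists p`_0.
by rewrite -size1_polyC //; move: (size p) sp => x; lia.
Qed.

Lemma size_cnormC c : size (cnorm (c%:P, 0)) = (c != 0).
Proof. by rewrite size_cnorm /= eqxx maxn0 size_polyC; case: (c != 0). Qed.

(** The larger pole comes from one of the coefficients of [f], whose leading term [g] cannot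
    cancel. *)
Lemma size_cnormDl f g : (size (cnorm g) < size (cnorm f))%N ->
  size (cnorm (f.1 + g.1, f.2 + g.2)) = size (cnorm f).
Proof.
rewrite !size_cnorm; case: f g => [p q] [p' q'] /=.
have := size_polyD p p'; have := size_polyD q q'.
have := @size_polyDl _ p p'; have := @size_polyDl _ q q'.
rewrite -!size_poly_eq0.
move: (size p) (size p') (size q) (size q') (size (p + p')) (size (q + q')) => x x' y y' z w.
by do 3!case: eqP => ?; lia.
Qed.

(** In Horner's scheme pole orders add at each product, and the constant added next cannot cancel a
    pole, since [n] is positive. *)
Lemma represents_comp f phi n P : represents f phi -> size (cnorm f) = n.+1 -> (0 < n)%N ->
  P != 0 -> exists2 g, represents g (fun x y => ev P (phi x y))
    & size (cnorm g) = ((size P).-1 * n).+1.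
Proof.
move=> hf sf n0; elim/poly_ind: P => [|P c IH]; first by rewrite eqxx.
have repC : represents (c%:P, 0) (fun _ _ => iota c).
  by move=> x y _; rewrite /= !evE mul0r addr0.
have [->|P0] := eqVneq P 0.
  rewrite mul0r add0r polyC_eq0 => c0; exists (c%:P, 0).
    by move=> x y xy; rewrite /= !evE mul0r addr0.
  by rewrite size_cnormC c0 size_polyC c0.
move=> _; have [g hg sg] := IH P0.
have sgf : size (cnorm (cmul g f)) = ((size P).-1 * n + n).+1.
  rewrite cnormM size_mul ?sg ?sf -?size_poly_eq0 ?sg ?sf //; lia.
exists ((cmul g f).1 + c%:P, (cmul g f).2 + 0).
  have h := representsD (representsM hg hf) repC.
  by move=> x y xy; rewrite -h // !evE.
rewrite (size_cnormDl (g := (c%:P, 0))) ?sgf; last first.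
  by rewrite size_cnormC; case: (c != 0); rewrite //= ltnS addn_gt0 n0 orbT.
have := P0; rewrite -size_poly_gt0 size_MXaddC (negbTE P0) /=.
by case: (size P) => // k _; rewrite mulSn addnC.
Qed.

(** In units of [n.+1], P(phi) has an even pole order and Q(phi) psi an odd one; when both are
    nonzero they cannot cancel, and the larger one is the pole order of the sum. *)
Lemma dvdn_pole f g phi psi n P Q h :
    represents f phi -> size (cnorm f) = n.+1.*2.+1 ->
    represents g psi -> size (cnorm g) = (n.+1 * 3).+1 ->
    represents h (fun x y => ev P (phi x y) + ev Q (phi x y) * psi x y) ->
  (n.+1 %| (size (cnorm h)).-1)%N.
Proof.
move=> hf sf hg sg hh.
have [P0|P0] := eqVneq P 0; have [Q0|Q0] := eqVneq Q 0.
- have [-> //] : h = (0%:P, 0).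
    by apply: represents_inj hh _ => x y _ /=; rewrite P0 Q0 !evE; ring.
  by rewrite size_cnormC eqxx.
- have [k hk sk] := represents_comp hf sf isT Q0.
  have -> : h = cmul k g.
    apply: represents_inj hh _ => x y xy.
    by rewrite -(representsM hk hg xy) P0 !evE; ring.
  rewrite cnormM size_mul ?sk ?sg -?size_poly_eq0 ?sk ?sg //.
  rewrite addSn addnS !succnK; apply: dvdn_add; last exact: dvdn_mulr.
  by rewrite -mul2n mulnA dvdn_mull.
- have [k hk sk] := represents_comp hf sf isT P0.
  have -> : h = k.
    by apply: represents_inj hh _ => x y xy; rewrite -(hk x y xy) Q0 !evE; ring.
  by rewrite sk succnK -mul2n mulnA dvdn_mull.
have [k hk sk] := represents_comp hf sf isT P0.
have [l hl sl] := represents_comp hf sf isT Q0.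
have slg : size (cnorm (cmul l g)) = ((size Q).-1 * n.+1.*2 + n.+1 * 3).+1.
  by rewrite cnormM size_mul -?size_poly_eq0 ?sl ?sg // addSn addnS.
have slgE : size (cnorm (cmul l g)) = (n.+1 * ((size Q).-1.*2 + 3)).+1.
  by rewrite slg; congr _.+1; rewrite mulnDr; lia.
have skE : size (cnorm k) = (n.+1 * (size P).-1.*2).+1 by rewrite sk; lia.
have := representsD hk (representsM hl hg).
have [lt|ge] := ltnP (size (cnorm k)) (size (cnorm (cmul l g))) => hs.
  rewrite (represents_inj hh (g := ((cmul l g).1 + k.1, (cmul l g).2 + k.2))).
    by rewrite size_cnormDl // slgE dvdn_mulr.
  by move=> x y xy; rewrite hs //= [k.1 + _]addrC [k.2 + _]addrC.
rewrite (represents_inj hh hs) size_cnormDl; first by rewrite skE dvdn_mulr.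
rewrite ltn_neqAle ge andbT slgE skE eqSS eqn_mul2l /=.
by apply/negP => /eqP /(congr1 odd); rewrite oddD !odd_double.
Qed.

(* The equation linking [phi] and [psi] gives them poles of orders 2n and 3n;
   then n divides the pole orders 2 and 3 of x and y, which are polynomials in
   [phi] plus [psi] times polynomials in [phi]. *)
Lemma poles_2_3 f g phi psi c (s P Q P' Q' : {poly F}) :
    represents f phi -> represents g psi -> size s = 4%N ->
    (forall x y, on x y ->
       psi x y ^+ 2 + iota c * psi x y = ev s (phi x y)) ->
    (forall x y, on x y -> x = ev P (phi x y) + ev Q (phi x y) * psi x y) ->
    (forall x y, on x y -> y = ev P' (phi x y) + ev Q' (phi x y) * psi x y) ->
  size (cnorm f) = 3%N /\ size (cnorm g) = 4%N.
Proof.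
move=> hf hg s4 eqs hX hY.
(* With [w] the relation between [phi] and [psi] reads w(psi) = s(phi). *)
pose w : {poly F} := 'X^2 + c%:P * 'X.
have sw : size w = 3%N.
  rewrite size_polyDl size_polyXn // mul_polyC.
  by rewrite (leq_ltn_trans (size_scale_leq _ _)) ?size_polyX.
have eqw x y : on x y -> ev w (psi x y) = ev s (phi x y).
  by move=> xy; rewrite !evE eqs.
have repC h a chi : h = (a%:P, 0) -> represents h chi ->
    forall x y, on x y -> chi x y = iota a.
  by move=> -> hh x y xy; rewrite hh //= !evE mul0r addr0.
have evI p a : ev p (iota a) = iota p.[a] by rewrite /ev horner_map.
have repEC p h a chi : h = (a%:P, 0) -> represents h chi ->
    represents (p.[a]%:P, 0) (fun x y => ev p (chi x y)).
  move=> hE hh x y xy; rewrite (repC _ _ _ hE hh) // evI /= !evE.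
  by rewrite mul0r addr0.
have hXr : represents ('X, 0) (fun x y => ev P (phi x y) + ev Q (phi x y) * psi x y).
  by move=> x y xy; rewrite -hX //= !evE mul0r addr0.
have hYr : represents (0, 1) (fun x y => ev P' (phi x y) + ev Q' (phi x y) * psi x y).
  by move=> x y xy; rewrite -hY //= ev0 evC rmorph1 mul1r add0r.
have w0 : w != 0 by rewrite -size_poly_gt0 sw.
have s0 : s != 0 by rewrite -size_poly_gt0 s4.
case sf : (size (cnorm f)) => [|[|d]].
(* Case of a constant [phi]: if [psi] is constant too, so is x; otherwise w(psi) has a pole and
   s(phi) has none. *)
1,2: have [|a fE] := @size_cnorm_le1 f; first by rewrite sf.
1,2: case sg : (size (cnorm g)) => [|[|e]].
1,2,4,5: have [|a' gE] := @size_cnorm_le1 g; first by rewrite sg.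
1-4: have /(represents_inj hXr) : represents ((P.[a] + Q.[a] * a')%:P, 0)
   (fun x y => ev P (phi x y) + ev Q (phi x y) * psi x y);
   first by move=> x y xy; rewrite (repC _ _ _ fE hf) // (repC _ _ _ gE hg) //
       !evI /= !evE mul0r addr0 -rmorphM -rmorphD.
1-4: by case=> /(congr1 (fun p : {poly F} => size p)) /eqP;
   rewrite size_polyX size_polyC; case: (_ != 0).
1,2: have [h hh sh] := represents_comp hg sg isT w0;
     have hs := repEC s _ _ _ fE hf;
     have hE : h = (s.[a]%:P, 0)
       by apply: represents_inj hh _ => x y xy; rewrite eqw // hs.
1,2: by move: sh; rewrite hE size_cnormC sw; case: (_ != 0).
have [h hh sh] := represents_comp hf sf isT s0.
(* Now s(phi) has a pole, so w(psi) has one and [psi] is not constant. *)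
case sg : (size (cnorm g)) => [|[|e]].
1,2: have [|a' gE] := @size_cnorm_le1 g; first by rewrite sg.
1,2: have hs := repEC w _ _ _ gE hg;
     have hE : h = (w.[a']%:P, 0)
       by apply: represents_inj hh _ => x y xy; rewrite -eqw // hs.
1,2: by move: sh; rewrite hE size_cnormC s4; case: (_ != 0).
have [k hk sk] := represents_comp hg sg isT w0.
have hkE : h = k.
  by apply: represents_inj hh _ => x y xy; rewrite -eqw // hk.
(* The pole orders in w(psi) = s(phi) give 2 [e.+1] = 3 [d.+1]. *)
have [n [dn en]] : exists n, d.+1 = n.+1.*2 /\ e.+1 = (n.+1 * 3)%N.
  by move: sh; rewrite hkE sk sw s4 => -[de]; exists (d.+1./2).-1; lia.
rewrite dn in sf; rewrite en in sg.
have := dvdn_pole hf sf hg sg hXr; have := dvdn_pole hf sf hg sg hYr.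
rewrite !size_cnorm /= !eqxx oner_eq0 size_polyX size_poly1 size_poly0 /=.
move=> n3 n2; have : (n.+1 %| 3 - 2)%N by rewrite dvdn_sub.
by rewrite dvdn1 => /eqP n0; rewrite dn en n0.
Qed.

(** A pole of order 2 excludes y, whose presence gives order at least 3. *)
Lemma size_cnorm3 f : size (cnorm f) = 3%N ->
  exists u v, u != 0 /\ f = (u%:P * 'X + v%:P, 0).
Proof.
rewrite size_cnorm; case: f => p q /=; case: eqP => [-> sp|/eqP]; last first.
  by rewrite -size_poly_gt0; move: (size p) (size q) => x y; lia.
have {}sp : size p = 2%N by move: (size p) sp => x; lia.
exists p`_1, p`_0; split.
  by move/eqP: (sp); rewrite -[2%N]/(1.+1) => /eqP E; rewrite -[1%N]/(2.-1) -sp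
    -lead_coefE lead_coef_eq0 -size_poly_eq0 sp.
congr pair; apply/polyP => i; rewrite coefD coefCM coefX coefC.
case: i => [|[|i]]; rewrite ?mulr0 ?add0r ?mulr1 ?addr0 //=.
by rewrite nth_default // sp.
Qed.

(** The odd order 3 must come from y, with a constant coefficient; this leaves degree at most 1 in x
    for the rest. *)
Lemma size_cnorm4 f : size (cnorm f) = 4%N ->
  exists v s t, v != 0 /\ f = (s%:P * 'X + t%:P, v%:P).
Proof.
rewrite size_cnorm; case: f => p q /=; case: eqP => [-> sp|/eqP].
  by move: (size p) sp => x; lia.
rewrite -size_poly_gt0 => q0 spq.
have [sp sq] : (size p <= 2)%N /\ size q == 1%N.
  by move: (size p) (size q) q0 spq => x y; lia.
have /size_poly1P[v v0 ->] := sq; exists v, p`_1, p`_0; split=> //.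
congr pair; apply/polyP => i; rewrite coefD coefCM coefX coefC.
case: i => [|[|i]]; rewrite ?mulr0 ?add0r ?mulr1 ?addr0 //=.
by rewrite nth_default // (leq_trans sp).
Qed.

(** * Functions regular on the affine curve *)

Lemma eq_regular phi psi : (forall x y, on x y -> phi x y = psi x y) ->
  regular phi -> regular psi.
Proof. by move=> e [f hf]; exists f => x y xy; rewrite -e // hf. Qed.

Lemma regularD phi psi :
  regular phi -> regular psi -> regular (fun x y => phi x y + psi x y).
Proof. by move=> [f hf] [g hg]; eexists; apply: representsD hf hg. Qed.

Lemma regularM phi psi :
  regular phi -> regular psi -> regular (fun x y => phi x y * psi x y).
Proof. by move=> [f hf] [g hg]; eexists; apply: representsM hf hg. Qed.

Lemma regular_ev p : regular (fun x _ => ev p x).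
Proof. by exists (p, 0) => x y _; rewrite /= ev0 mul0r addr0. Qed.

Lemma regularC c : regular (fun _ _ => iota c).
Proof. by apply: eq_regular (regular_ev c%:P) => x y _; rewrite evC. Qed.

Lemma regularX : regular (fun x _ => x).
Proof. by apply: eq_regular (regular_ev 'X) => x y _; rewrite evX. Qed.

Lemma regularY : regular (fun _ y => y).
Proof. by exists (0, 1) => x y _; rewrite /= ev0 evC rmorph1 mul1r add0r. Qed.

(* The polynomials in x that are denominators of [phi] form an ideal of F[X];
   taking norms of denominators shows that it has no zero in K. *)
Lemma regular_fraction phi :
    (forall x y, on x y -> exists d n, [/\ regular d, regular n, d x y != 0
      & forall x' y', on x' y' -> d x' y' != 0 -> d x' y' * phi x' y' = n x' y']) ->
  regular phi.
Proof.
move=> frac.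
pose den d := regular d /\ regular (fun x y => d x y * phi x y).
have denP x y : on x y -> exists2 d, den d & d x y != 0.
  (* The square is taken because d phi = n is known only where d is nonzero, while d^2 phi = d n
     holds on the whole curve. *)
  move=> /frac[d [n [dreg nreg d0 dn]]]; exists (fun x y => d x y * d x y).
    split; first exact: regularM.
    apply: eq_regular (regularM dreg nreg) => x' y' xy'.
    have [->|d0'] := eqVneq (d x' y') 0; first by rewrite !mul0r.
    by rewrite -mulrA dn.
  by rewrite mulf_neq0.
have norm_den x : exists2 h : {poly F}, ev h x != 0 & regular (fun x y => ev h x * phi x y).
  have [y xy] := exists_on x; pose y' := - y - iota b.
  have xy' : on x y' by rewrite on_conj.
  have [d [dreg dphi] /andP[dy dy']] :
      exists2 d, den d & (d x y != 0) && (d x y' != 0).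
    have [d dd dy] := denP _ _ xy; have [e de ey'] := denP _ _ xy'.
    have [dy'0|dy'] := eqVneq (d x y') 0; last by exists d; rewrite ?dy.
    have [ey0|ey] := eqVneq (e x y) 0; last by exists e; rewrite ?ey.
    (* Here [d] vanishes at the second point and [e] at the first, so the sum vanishes at
       neither. *)
    exists (fun x y => d x y + e x y); last by rewrite dy'0 ey0 addr0 add0r dy.
    case: dd de => [d1 d2] [e1 e2]; split; first exact: regularD.
    apply: eq_regular (regularD d2 e2) => x1 y1 _; exact/esym/mulrDl.
  have [f hf] := dreg; exists (cnorm f).
    by rewrite (ev_cnorm hf xy) mulf_neq0.
  apply: eq_regular (regularM _ dphi); last by exists (cconj f); apply: represents_conj hf.
  by move=> x1 y1 xy1; rewrite (ev_cnorm hf xy1) /=; ring.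
pose I (h : {poly F}) := regular (fun x y => ev h x * phi x y).
have IM (h k : {poly F}) : I k -> I (h * k).
  move=> Ik; apply: eq_regular (regularM (regular_ev h) Ik) => x y _.
  by rewrite evM mulrA.
have IB (h k : {poly F}) : I h -> I k -> I (h - k).
  move=> Ih Ik; apply: eq_regular (regularD Ih (IM (-1)%:P _ Ik)) => x y _.
  by rewrite !evE rmorphN1; ring.
(* Take a nonzero [h] in [I] of least size. If it had a root, some [k] in [I] would not vanish
   there, and [k %% h] would be a smaller nonzero member. *)
pose S n := `[< exists2 h : {poly F}, h != 0 /\ size h = n & I h >].
have exS : exists n, S n.
  have [h h0 Ih] := norm_den 0; exists (size h); apply/asboolP; exists h => //.
  by split=> //; apply: contraNneq h0 => ->; rewrite ev0.
case: (ex_minnP exS) => n /asboolP[h [h0 sh] Ih] minh.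
have [/size_poly1P[c c0 hc]|/(ev_root iota)[x hx]] := boolP (size h == 1%N).
  have := regularM (regularC c^-1) Ih; apply: eq_regular => x y _.
  by rewrite mulrA hc evC -rmorphM mulVf // rmorph1 mul1r.
have [k kx Ik] := norm_den x; have kE := divp_eq k h.
have Im : I (k %% h).
  have -> : k %% h = k - k %/ h * h by apply/eqP; rewrite eq_sym subr_eq addrC -kE.
  by apply: IB => //; apply: IM.
have [m0|m0] := eqVneq (k %% h) 0.
  by case/eqP: kx; rewrite kE m0 addr0 evM hx mulr0.
have /minh : S (size (k %% h)) by apply/asboolP; exists (k %% h).
by rewrite leqNgt -sh ltn_modp h0.
Qed.

End CoordinateRing.

(** * Isomorphisms are affine substitutions *)

Definition ss_model (F : fieldType) (E : cubic F) :=
  [&& 2%N \in [pchar F], a0 E != 0, a1 E == 0 & a3 E != 0].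

Definition crhs (F : fieldType) (E : cubic F) : {poly F} :=
  (a0 E)%:P * 'X^3 + (a2 E)%:P * 'X^2 + (a4 E)%:P * 'X + (a6 E)%:P.

Lemma size_crhs (F : fieldType) (E : cubic F) : a0 E != 0 -> size (crhs E) = 4%N.
Proof.
move=> a0_neq0.
rewrite /crhs -!addrA !mul_polyC size_polyDl size_scale ?size_polyXn //.
rewrite (leq_ltn_trans (size_polyD _ _)) // gtn_max.
rewrite (leq_ltn_trans (size_scale_leq _ _)) ?size_polyXn //=.
rewrite (leq_ltn_trans (size_polyD _ _)) // gtn_max.
rewrite (leq_ltn_trans (size_scale_leq _ _)) ?size_polyX //=.
by rewrite (leq_ltn_trans (size_polyC_leq1 _)).
Qed.

Definition amap (R : pzRingType) (u v r s t : R) (P : option (R * R)) :=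
  if P is Some (x, y) then Some (u * x + r, v * y + s * x + t) else None.

Lemma amapK (R : fieldType) (u v r s t : R) : u != 0 -> v != 0 ->
  cancel (amap u v r s t)
    (amap u^-1 v^-1 (- r / u) (- s / (u * v)) ((s * r / u - t) / v)).
Proof.
move=> u0 v0 [[x y]|//] /=; congr (Some (_, _)); field => //.
by rewrite u0 v0.
Qed.

Lemma amapVK (R : fieldType) (u v r s t : R) : u != 0 -> v != 0 ->
  cancel (amap u^-1 v^-1 (- r / u) (- s / (u * v)) ((s * r / u - t) / v))
    (amap u v r s t).
Proof.
move=> u0 v0 [[x y]|//] /=; congr (Some (_, _)); field => //.
by rewrite u0 v0.
Qed.

Section Morphisms.
Variables (F : fieldType) (K : closedFieldType) (iota : {rmorphism F -> K}).
Implicit Types (C E : cubic F).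

Definition affpt E x y (xy : on_cubic (map_cubic iota E) (Some (x, y))) : gpts iota E :=
  exist (fun P => is_true (on_cubic (map_cubic iota E) P)) (Some (x, y)) xy.

Lemma on_cubicE E x y : ss_model E ->
  on_cubic (map_cubic iota E) (Some (x, y)) = on iota (a3 E) (crhs E) x y.
Proof.
case/and4P=> _ _ /eqP a1_eq0 _.
by rewrite /on /= a1_eq0 rmorph0 !mul0r addr0 /crhs !evE.
Qed.

(** Inverses are unique, so [g] is the regular inverse that [ec_iso f] provides. *)
Lemma ec_iso_inv C E (f : gpts iota C -> gpts iota E) (g : gpts iota E -> gpts iota C) :
  ec_iso f -> cancel f g -> cancel g f -> ec_iso g.
Proof.
case=> [freg f0 [g' [g'reg fg' g'f]]] fg gf.
have -> : g = g' by apply/funext => Q; rewrite -{1}(g'f Q) fg.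
by split=> //; [rewrite -f0 fg' | exists f].
Qed.

(** A homogeneous coordinate of the image of (x, y), with default value 0 off the curve. *)
Definition fcoord C E (f : gpts iota C -> gpts iota E) (i : 'I_3) (x y : K) : K :=
  if insub (Some (x, y)) is Some P then tnth (hcoord (val (f P))) i else 0.

Lemma regular_form b p (G : {mpoly F[3]}) :
  regular iota b p (fun x y => form_at iota G (Some (x, y))).
Proof.
have reg_big (op : K -> K -> K) (idx : F) (T : Type) (s : seq T) (h : T -> K -> K -> K) :
    (forall phi psi, regular iota b p phi -> regular iota b p psi ->
       regular iota b p (fun x y => op (phi x y) (psi x y))) ->
    (forall i, regular iota b p (h i)) ->
    regular iota b p (fun x y => \big[op/iota idx]_(i <- s) h i x y).
  move=> opP hP; elim: s => [|i s IH].
    by apply: eq_regular (regularC iota b p idx) => x y _; rewrite big_nil.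
  by apply: eq_regular (opP _ _ (hP i) IH) => x y _; rewrite big_cons.
rewrite /form_at /mmap -(rmorph0 iota).
apply: (reg_big) => [phi psi|m]; first exact: regularD.
apply: regularM; first exact: regularC.
rewrite /mmap1 -(rmorph1 iota).
apply: (reg_big) => [phi psi|i]; first exact: regularM.
have reg_i : regular iota b p (fun x y => tnth (hcoord (Some (x, y))) i).
  case: i => [[|[|[|//]]] lti].
  - exact: regularX.
  - exact: regularY.
  - by apply: eq_regular (regularC iota b p 1) => x y _; rewrite rmorph1.
elim: (m i) => [|k IH].
  by apply: eq_regular (regularC iota b p 1) => x y _; rewrite expr0 rmorph1.
by apply: eq_regular (regularM reg_i IH) => x y _; rewrite exprS.
Qed.

Section Coordinates.
Variables (C E : cubic F) (f : gpts iota C -> gpts iota E).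
Hypotheses (C_ss : ss_model C) (freg : regular_map f) (f_inj : injective f).
Hypothesis (f0 : f (origin _) = origin _).

Let i0 : 'I_3 := inord 0.
Let i1 : 'I_3 := inord 1.
Let i2 : 'I_3 := inord 2.

(** By injectivity only the origin maps to the origin, so affine points have affine images. *)
Lemma val_fcoord (P : gpts iota C) x y : val P = Some (x, y) ->
  val (f P) = Some (fcoord f i0 x y, fcoord f i1 x y).
Proof.
move=> Pxy; rewrite /fcoord -Pxy valK.
case fP : (val (f P)) => [[X Y]|].
  by rewrite /= !(tnth_nth 0) /= !inordK.
have : f P = f (origin _) by rewrite f0; apply: val_inj.
by move/f_inj => P0; rewrite P0 in Pxy.
Qed.

(** An affine image has third homogeneous coordinate 1, so locally the coordinate is [G i] over
    [G i2], with denominator nonzero at the chosen point. *)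
Lemma regular_fcoord i : regular iota (a3 C) (crhs C) (fcoord f i).
Proof.
have [char2 C0 _ C3] := and4P C_ss.
apply: regular_fraction => x y; rewrite -on_cubicE // => xy.
pose P : gpts iota C := affpt xy.
have [d [G [_ [j Gj] GE]]] := freg P.
have h2 (Q : gpts iota C) x' y' : val Q = Some (x', y') ->
    tnth (hcoord (val (f Q))) i2 = 1.
  by move=> /val_fcoord ->; rewrite (tnth_nth 0) /= inordK.
exists (fun x y => form_at iota (G i2) (Some (x, y))).
exists (fun x y => form_at iota (G i) (Some (x, y))).
split; try exact: regular_form.
  have [|c c0 cE] := GE P; first by exists j.
  by rewrite (cE i2) (h2 P x y) // mulr1.
move=> x' y'; rewrite -on_cubicE // => xy'; pose Q : gpts iota C := affpt xy'.
move=> Q2; have [|c c0 cE] := GE Q; first by exists i2.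
rewrite (cE i2) (cE i) (h2 Q x' y') // mulr1 /fcoord.
by rewrite -[Some (x', y')]/(val Q) valK.
Qed.

Lemma regular_coord : exists p1 p2, forall (P : gpts iota C) x y, val P = Some (x, y) ->
  val (f P) = Some (ev iota p1.1 x + ev iota p1.2 x * y,
                    ev iota p2.1 x + ev iota p2.2 x * y).
Proof.
have [p1 h1] := regular_fcoord i0; have [p2 h2] := regular_fcoord i1.
exists p1, p2 => P x y Pxy; have xy : on iota (a3 C) (crhs C) x y.
  by rewrite -on_cubicE // -Pxy; apply: valP.
by rewrite (val_fcoord Pxy) h1 // h2.
Qed.

End Coordinates.

(** The coordinates of [f] and of its inverse are regular, so [poles_2_3] applies, and poles of
    orders 2 and 3 force the affine shape. *)
Lemma ec_iso_affine C E (f : gpts iota C -> gpts iota E) :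
    ss_model C -> ss_model E -> ec_iso f ->
  exists u v r s t, [/\ u != 0, v != 0 & forall P,
    val (f P) = amap (iota u) (iota v) (iota r) (iota s) (iota t) (val P)].
Proof.
move=> C_ss E_ss [freg f0 [g [greg fg gf]]].
have g0 : g (origin _) = origin _ by rewrite -f0 fg.
have [p1 [p2 fE]] := regular_coord C_ss freg (can_inj fg) f0.
have [q1 [q2 gE]] := regular_coord E_ss greg (can_inj gf) g0.
have [char2 C0 _ C3] := and4P C_ss.
have [_ E0 _ _] := and4P E_ss.
pose phi x y := ev iota p1.1 x + ev iota p1.2 x * y.
pose psi x y := ev iota p2.1 x + ev iota p2.2 x * y.
have gfE x y : on iota (a3 C) (crhs C) x y ->
    x = ev iota q1.1 (phi x y) + ev iota q1.2 (phi x y) * psi x y /\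
    y = ev iota q2.1 (phi x y) + ev iota q2.2 (phi x y) * psi x y.
  rewrite -on_cubicE // => xy; pose P : gpts iota C := affpt xy.
  by have := gE (f P) _ _ (fE P _ _ erefl); rewrite fg => -[].
have onE x y : on iota (a3 C) (crhs C) x y ->
    psi x y ^+ 2 + iota (a3 E) * psi x y = ev iota (crhs E) (phi x y).
  rewrite -on_cubicE // => xy; pose P : gpts iota C := affpt xy.
  by have := valP (f P); rewrite (fE P _ _ erefl) on_cubicE // => /eqP.
have hphi : represents iota (a3 C) (crhs C) p1 phi by [].
have hpsi : represents iota (a3 C) (crhs C) p2 psi by [].
have [s3 s4] := poles_2_3 char2 C3 (size_crhs C0) hphi hpsi (size_crhs E0) onE
  (fun x y xy => proj1 (gfE x y xy)) (fun x y xy => proj2 (gfE x y xy)).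
have [u [r [u0 p1E]]] := size_cnorm3 char2 C3 (size_crhs C0) s3.
have [v [s [t [v0 p2E]]]] := size_cnorm4 char2 C3 (size_crhs C0) s4.
exists u, v, r, s, t; split=> // P.
case Pxy : (val P) => [[x y]|].
  rewrite (fE _ _ _ Pxy) p1E p2E /= !evE mul0r addr0.
  by congr (Some (_, _)); ring.
by have -> : P = origin _ by [apply: val_inj; rewrite Pxy]; rewrite f0.
Qed.

End Morphisms.

(** * Affine substitutions as morphisms *)

Section AffineMaps.
Variables (F : fieldType) (K : closedFieldType) (iota : {rmorphism F -> K}).
Implicit Types (C D E : cubic F).

Definition affine_for C E (f : gpts iota C -> gpts iota E) u v r s t :=
  forall P, val (f P) = amap (iota u) (iota v) (iota r) (iota s) (iota t) (val P).

Definition affine C E (f : gpts iota C -> gpts iota E) :=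
  exists u v r s t, [/\ u != 0, v != 0 & affine_for f u v r s t].

Lemma affine_comp C D E (f : gpts iota C -> gpts iota D) (g : gpts iota D -> gpts iota E) :
  affine f -> affine g -> affine (g \o f).
Proof.
move=> [u [v [r [s [t [u0 v0 fE]]]]]] [u' [v' [r' [s' [t' [u0' v0' gE]]]]]].
exists (u' * u), (v' * v), (u' * r + r'), (v' * s + s' * u), (v' * t + s' * r + t').
split; rewrite ?mulf_neq0 // => P; rewrite /comp gE fE.
by case: (val P) => [[x y]|//]; rewrite /=; congr (Some (_, _)); ring.
Qed.

Lemma affine_inv C E (f : gpts iota C -> gpts iota E) (g : gpts iota E -> gpts iota C) :
  affine f -> cancel g f -> affine g.
Proof.
move=> [u [v [r [s [t [u0 v0 fE]]]]]] gf.
exists u^-1, v^-1, (- r / u), (- s / (u * v)), ((s * r / u - t) / v).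
split; rewrite ?invr_neq0 // => Q; rewrite -{2}(gf Q) fE.
by rewrite !(rmorphM, rmorphN, rmorphB, fmorphV) amapK ?fmorph_eq0.
Qed.

(** A single triple of linear forms serves at every point. *)
Lemma affine_regular C E (f : gpts iota C -> gpts iota E) :
  affine f -> regular_map f.
Proof.
move=> [u [v [r [s [t [u0 v0 fE]]]]]] P; exists 1%N.
pose X i : {mpoly F[3]} := 'X_(inord i).
exists (tnth [tuple u *: X 0 + r *: X 2; v *: X 1 + s *: X 0 + t *: X 2; X 2]).
set G := tnth _.
have GE (Q : option (K * K)) : exists2 c, c != 0 & forall i, form_at iota (G i) Q =
    c * tnth (hcoord (amap (iota u) (iota v) (iota r) (iota s) (iota t) Q)) i.
  (* The forms send (0, 1, 0) to (0, v, 0), whence the scalar v at infinity. *)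
  exists (if Q is Some _ then 1 else iota v).
    by case: Q => [_|]; rewrite ?oner_neq0 ?fmorph_eq0.
  have XE k : (k < 3)%N -> mmap iota (tnth (hcoord Q)) (X k) = nth 0 (hcoord Q) k.
    by move=> k3; rewrite mmapX mmap1U (tnth_nth 0) inordK.
  case=> [[|[|[|//]]] lti]; rewrite /form_at /G (tnth_nth 0) /=
    ?mmapD ?mmapZ !XE // (tnth_nth 0) /=; case: Q {XE} => [[x y]|] /=; ring.
split.
- have X1 k : X k \is 1.-homog by rewrite dhomogX /= mdeg1.
  by case=> [[|[|[|//]]] lti]; rewrite /G (tnth_nth 0) /= ?rpredD ?rpredZ.
- have [c c0 cE] := GE (val P).
  have [i Pi] : exists i, tnth (hcoord (val (f P))) i != 0.
    case: (val (f P)) => [[x y]|].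
      by exists (inord 2); rewrite (tnth_nth 0) /= inordK ?oner_neq0.
    by exists (inord 1); rewrite (tnth_nth 0) /= inordK ?oner_neq0.
  by exists i; rewrite cE -fE mulf_neq0.
by move=> Q _; have [c c0 cE] := GE (val Q); exists c => // i; rewrite cE fE.
Qed.

(** The inverse of an affine bijection is affine, hence regular. *)
Lemma ec_isoP C E (f : gpts iota C -> gpts iota E) : ss_model C -> ss_model E ->
  ec_iso f <-> affine f /\ bijective f.
Proof.
move=> C_ss E_ss; split=> [f_iso|[f_aff [g fg gf]]].
  split; first exact: ec_iso_affine.
  by case: f_iso => _ _ [g [_ fg gf]]; exists g.
split; first exact: affine_regular.
  by have [u [v [r [s [t [_ _ fE]]]]]] := f_aff; apply: val_inj; rewrite fE.
by exists g; split=> //; apply/affine_regular/(affine_inv f_aff).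
Qed.

End AffineMaps.

(** * Substitutions from the family, and their number *)

Section FamilyMaps.
Variables (F : fieldType) (K : closedFieldType) (iota : {rmorphism F -> K}).
Variables (E : cubic F) (E_ss : ss_model E) (lam mu : F).
Implicit Types u v r s t : F.

Let C := family_curve lam mu.

(* The vanishing, in characteristic 2, of the coefficients of the difference
   between the equation of E at (u x + r, v y + s x + t) and
   v^2 (y^2 + y - lam x - mu x^3). *)
Definition substitutes u v r s t :=
  [/\ a3 E * v - v ^+ 2 = 0,
      v ^+ 2 * mu - a0 E * u ^+ 3 = 0,
      s ^+ 2 - u ^+ 2 * (a0 E * r + a2 E) = 0,
      v ^+ 2 * lam + a3 E * s - a0 E * u * r ^+ 2 - a4 E * u = 0
    & on_cubic E (Some (r, t))].

Lemma two_eq0 : 2%:R = 0 :> F.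
Proof. by case/and4P: E_ss => /andP[_ /eqP]. Qed.

Lemma family_ss : mu != 0 -> ss_model C.
Proof.
move=> mu0; case/and4P: E_ss => c2 _ _ _.
by rewrite /ss_model c2 mu0 /= eqxx oner_eq0.
Qed.

Lemma substitution_identity u v r s t x y :
  (iota v * y + iota s * x + iota t) ^+ 2 + iota (a3 E) * (iota v * y + iota s * x + iota t)
    - ev iota (crhs E) (iota u * x + iota r)
  = iota v ^+ 2 * (y ^+ 2 + y - ev iota (crhs C) x)
    + iota (a3 E * v - v ^+ 2) * y
    + iota (v ^+ 2 * mu - a0 E * u ^+ 3) * x ^+ 3
    + iota (s ^+ 2 - u ^+ 2 * (a0 E * r + a2 E)) * x ^+ 2
    + iota (v ^+ 2 * lam + a3 E * s - a0 E * u * r ^+ 2 - a4 E * u) * x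
    + iota (t ^+ 2 + a3 E * t - (crhs E).[r]).
Proof.
(* Formally the left side minus the right side is 2 [err]: the cross terms of the squares, and what
   the cube leaves once 3 is split as 1 + 2. *)
pose err : K := iota v * iota s * x * y + iota v * iota t * y + iota s * iota t * x
  - iota (a0 E) * iota u ^+ 2 * iota r * x ^+ 2
  - iota (a0 E) * iota u * iota r ^+ 2 * x - iota (a2 E) * iota u * iota r * x.
rewrite -[RHS]addr0 -[0](mul0r err) -(rmorph0 iota) -two_eq0.
rewrite /crhs !evE !hornerE /C /= /err.
ring.
Qed.

Lemma on_rational r t : on_cubic E (Some (r, t)) = (t ^+ 2 + a3 E * t - (crhs E).[r] == 0).
Proof.
have /eqP a1_eq0 : a1 E == 0 by case/and4P: E_ss.
by rewrite /= a1_eq0 !mul0r addr0 subr_eq0 /crhs !hornerE.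
Qed.

(** Once the listed coefficients vanish, the two equations differ by the nonzero factor v^2. *)
Lemma on_substitution u v r s t : mu != 0 -> v != 0 -> substitutes u v r s t ->
  forall P, on_cubic (map_cubic iota E)
      (amap (iota u) (iota v) (iota r) (iota s) (iota t) P)
    = on_cubic (map_cubic iota C) P.
Proof.
move=> mu0 v0 [h1 h2 h3 h4]; rewrite on_rational => /eqP h5 [[x y]|//].
rewrite [amap _ _ _ _ _ _]/= !on_cubicE //; last exact: family_ss.
rewrite /on -subr_eq0 substitution_identity h1 h2 h3 h4 h5 rmorph0 !mul0r !addr0.
by rewrite mulf_eq0 sqrf_eq0 fmorph_eq0 (negbTE v0) rmorph1 mul1r subr_eq0.
Qed.

Lemma cubic_eq0 (c0 c1 c2 c3 : F) :
    c3%:P * 'X^3 + c2%:P * 'X^2 + c1%:P * 'X + c0%:P = 0 :> {poly F} ->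
  [/\ c0 = 0, c1 = 0, c2 = 0 & c3 = 0].
Proof.
move=> /polyP e; have := (e 0, e 1, e 2, e 3)%N.
rewrite !(coefD, coefCM, coefXn, coefX, coefC) /= !mulr0 !mulr1 !addr0 !add0r.
by case=> [[[]]].
Qed.

(** On [C] the identity leaves a cubic in x plus a constant times y, which vanishes there;
    uniqueness of representation kills each coefficient. *)
Lemma substitution_on u v r s t : mu != 0 ->
    (forall P, on_cubic (map_cubic iota C) P -> on_cubic (map_cubic iota E)
      (amap (iota u) (iota v) (iota r) (iota s) (iota t) P)) ->
  substitutes u v r s t.
Proof.
move=> mu0 CE; have C_ss := family_ss mu0.
have [char2 C0 _ C3] := and4P C_ss.
pose c0 := t ^+ 2 + a3 E * t - (crhs E).[r].
pose c1 := v ^+ 2 * lam + a3 E * s - a0 E * u * r ^+ 2 - a4 E * u.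
pose c2 := s ^+ 2 - u ^+ 2 * (a0 E * r + a2 E).
pose c3 := v ^+ 2 * mu - a0 E * u ^+ 3.
pose c : F := a3 E * v - v ^+ 2.
pose p : {poly F} := c3%:P * 'X^3 + c2%:P * 'X^2 + c1%:P * 'X + c0%:P.
have h : represents iota (a3 C) (crhs C) (p, c%:P) (fun _ _ => 0).
  move=> x y xy; have := CE (Some (x, y)).
  rewrite [amap _ _ _ _ _ _]/= !on_cubicE // => /(_ xy).
  rewrite /on -subr_eq0 substitution_identity => /eqP <-.
  rewrite -(eqP xy) /= rmorph1 mul1r subrr mulr0 add0r !evE /c0 /c1 /c2 /c3 /c.
  ring.
have h0 : represents iota (a3 C) (crhs C) (0, 0) (fun _ _ => 0).
  by move=> x y _; rewrite /= !evE mul0r addr0.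
case: (represents_inj char2 C3 h h0) => /cubic_eq0[e0 e1 e2 e3].
move/eqP; rewrite polyC_eq0 => /eqP e.
by split=> //; rewrite on_rational -/c0 e0.
Qed.

Variables (sqrt2 : F -> F) (sqrt2K : forall w, sqrt2 w ^+ 2 = w).

(** The conditions [substitutes] solved with v = [a3 E]: the third gives s, the fourth [lam], the
    second [mu]. *)
Definition par_s u r := u * sqrt2 (a0 E * r + a2 E).
Definition par_lam u r :=
  (a0 E * u * r ^+ 2 + a4 E * u - a3 E * par_s u r) / a3 E ^+ 2.
Definition par_mu u := a0 E * u ^+ 3 / a3 E ^+ 2.

Lemma substitutesP u v r s t : v != 0 -> substitutes u v r s t <->
  [/\ v = a3 E, s = par_s u r, on_cubic E (Some (r, t)), lam = par_lam u r & mu = par_mu u].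
Proof.
move=> v0; have a30 : a3 E != 0 by case/and4P: E_ss.
have par_sE : par_s u r ^+ 2 = u ^+ 2 * (a0 E * r + a2 E).
  by rewrite exprMn sqrt2K.
split=> [[e1 e2 e3 e4 e5]|[-> -> e5 lamE muE]]; last first.
  rewrite /substitutes lamE muE.
  by split; rewrite ?par_sE ?subrr // /par_lam /par_mu; field.
have va : v = a3 E.
  apply/eqP; rewrite eq_sym -subr_eq0 -(mulIr_eq0 _ (mulIf v0)).
  by rewrite mulrBl -expr2 e1.
have ss : s = par_s u r.
  apply/eqP; rewrite -subr_eq0 -sqrf_eq0.
  have -> : (s - par_s u r) ^+ 2
      = s ^+ 2 - par_s u r ^+ 2 + 2%:R * (par_s u r ^+ 2 - s * par_s u r) by ring.
  by rewrite par_sE e3 two_eq0 mul0r addr0.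
rewrite -va in a30 *; split=> //; rewrite -?ss.
  rewrite /par_lam -ss -va; apply: (mulIf (expf_neq0 2 v0)).
  rewrite divfK ?expf_neq0 //; apply/eqP; rewrite -subr_eq0 -e4 va.
  by apply/eqP; ring.
rewrite /par_mu -va; apply: (mulIf (expf_neq0 2 v0)).
by rewrite divfK ?expf_neq0 //; apply/eqP; rewrite -subr_eq0 -e2 mulrC.
Qed.

End FamilyMaps.

(** * From supersingularity to the shape of the equation *)

(** A point with a1 x + a3 = 0 is its own opposite, hence of order 2; over [K] one exists unless a1
    = 0 and a3 is nonzero. *)
Lemma ss_model_supersingular (F : fieldType) (K : closedFieldType)
    (iota : {rmorphism F -> K}) (E : cubic F) :
  2%N \in [pchar F] -> elliptic iota E -> supersingular iota E -> ss_model E.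
Proof.
move=> char2 [E0 _] ss; rewrite /ss_model char2 E0 /=.
have two0 : 2%:R = 0 :> K.
  by rewrite -(rmorph_nat iota); case/andP: char2 => _ /eqP->; rewrite rmorph0.
have no2 x y : iota (a1 E) * x + iota (a3 E) = 0 ->
    ~ on_cubic (map_cubic iota E) (Some (x, y)).
  move=> h xy; apply: (ss (affpt xy)); split; first by move/(congr1 val).
  rewrite /= eqxx /= ifT //; apply/eqP; rewrite -addrA -opprD h subr0.
  by apply/eqP; rewrite -subr_eq0 opprK -mulr2n -mulr_natl two0 mul0r.
have no_zero x : iota (a1 E) * x + iota (a3 E) <> 0.
  move=> h; have [y hy] := quadratic_root 0 (iota (a0 E) * x ^+ 3
    + iota (a2 E) * x ^+ 2 + iota (a4 E) * x + iota (a6 E)).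
  apply: (no2 x y h); rewrite /= -hy mul0r addr0 -addrA -mulrDl h mul0r addr0 //.
have [a10|a10] := eqVneq (a1 E) 0; last first.
  case: (no_zero (- iota (a3 E) / iota (a1 E))).
  by rewrite mulrC divfK ?fmorph_eq0 // addNr.
by apply/eqP => a30; apply: (no_zero 0); rewrite a30 rmorph0 mulr0 addr0.
Qed.

(** * Counting isomorphisms by their parameters (u, (r, t)) *)

Section Isomorphisms.
Variables (F : finFieldType) (K : closedFieldType) (iota : {rmorphism F -> K}).
Variables (E : cubic F) (E_ss : ss_model E).
Variables (sqrt2 : F -> F) (sqrt2K : forall w, sqrt2 w ^+ 2 = w).

Local Notation par := (F * (F * F))%type.
Local Notation fam lm := (family_curve lm.1 lm.2).

Definition pars : {set par} :=
  [set p | (p.1 != 0) && on_cubic E (Some p.2)].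

Definition par_curve (p : par) : F * F :=
  (par_lam E sqrt2 p.1 p.2.1, par_mu E p.1).

Definition par_amap (p : par) : option (K * K) -> option (K * K) :=
  amap (iota p.1) (iota (a3 E)) (iota p.2.1) (iota (par_s E sqrt2 p.1 p.2.1))
    (iota p.2.2).

(** The source [C] is left free so that maps of all parameters above one member of the family share
    a type; the origin is the default when the image is off [E]. *)
Definition par_map C (p : par) (P : gpts iota C) : gpts iota E :=
  insubd (origin (map_cubic iota E)) (par_amap p (val P)).

Let a3_neq0 : a3 E != 0. Proof. by case/and4P: E_ss. Qed.

Lemma par_mu_neq0 u : u != 0 -> par_mu E u != 0.
Proof.
by move=> u0; rewrite !mulf_neq0 ?invr_neq0 ?expf_neq0 //; case/and4P: E_ss.
Qed.

Lemma par_substitutes p : p \in pars ->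
  substitutes E (par_curve p).1 (par_curve p).2 p.1 (a3 E) p.2.1
    (par_s E sqrt2 p.1 p.2.1) p.2.2.
Proof.
rewrite inE => /andP[p0 onp]; apply/(substitutesP E_ss _ _ sqrt2K) => //.
by split=> //; rewrite -surjective_pairing.
Qed.

Lemma on_par_amap p P : p \in pars ->
  on_cubic (map_cubic iota E) (par_amap p P)
  = on_cubic (map_cubic iota (fam (par_curve p))) P.
Proof.
move=> p_par; apply: on_substitution (par_substitutes p_par) _ => //.
by move: p_par; rewrite inE => /andP[p0 _]; apply: par_mu_neq0.
Qed.

Lemma val_par_map lm p (P : gpts iota (fam lm)) : p \in pars -> par_curve p = lm ->
  val (par_map p P) = par_amap p (val P).
Proof.
move=> p_par plm; apply: insubdK.
by rewrite -[_ \in _]/(on_cubic _ _) on_par_amap // plm; apply: (valP P).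
Qed.

Lemma par_map_iso p : p \in pars ->
  ec_iso (par_map p : gpts iota (fam (par_curve p)) -> _).
Proof.
move=> p_par; have := p_par; rewrite inE => /andP[p0 _].
apply/ec_isoP => //; first by apply: (family_ss E_ss); apply: par_mu_neq0.
split.
  exists p.1, (a3 E), p.2.1, (par_s E sqrt2 p.1 p.2.1), p.2.2; split=> // P.
  exact: (@val_par_map (par_curve p)).
have u0 : iota p.1 != 0 by rewrite fmorph_eq0.
have v0 : iota (a3 E) != 0 by rewrite fmorph_eq0.
have aK := amapK (iota p.2.1) (iota (par_s E sqrt2 p.1 p.2.1)) (iota p.2.2) u0 v0.
have a'K := amapVK (iota p.2.1) (iota (par_s E sqrt2 p.1 p.2.1)) (iota p.2.2) u0 v0.
set b := amap _^-1 _ _ _ _ in aK a'K.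
exists (fun Q => insubd (origin _) (b (val Q))) => [P|Q]; apply: val_inj.
  by rewrite val_insubd val_par_map // aK ifT //; apply: valP.
(* As [on_par_amap] is an equality, the inverse substitution brings points of [E] back to the
   curve. *)
have onb : on_cubic (map_cubic iota (fam (par_curve p))) (b (val Q)).
  by rewrite -on_par_amap // /par_amap a'K; apply: valP.
by rewrite val_par_map // insubdK //; apply: a'K.
Qed.

Lemma par_map_onto lm (f : gpts iota (fam lm) -> gpts iota E) :
  lm.2 != 0 -> ec_iso f -> exists p, [/\ p \in pars, par_curve p = lm & f = par_map p].
Proof.
case: lm f => lam mu f /= mu0 f_iso; have C_ss := family_ss E_ss lam mu0.
have [[u [v [r [s [t [u0 v0 fE]]]]]] _] := (ec_isoP f C_ss E_ss).1 f_iso.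
have CE P : on_cubic (map_cubic iota (family_curve lam mu)) P ->
   on_cubic (map_cubic iota E) (amap (iota u) (iota v) (iota r) (iota s) (iota t) P).
  move=> onP; rewrite -[P]/(val (exist (fun P => is_true (on_cubic _ P)) P onP)).
  by rewrite -fE; apply: valP.
have /(substitutesP E_ss _ _ sqrt2K)[] := substitution_on E_ss mu0 CE => //.
move=> vE sE onp lamE muE; exists (u, (r, t)); split.
- by rewrite inE u0 onp.
- by rewrite /par_curve -lamE -muE.
apply/funext => P; apply: val_inj; rewrite /par_map /par_amap /= -sE -vE -fE.
by rewrite valKd.
Qed.

Lemma par_map_inj lm p p' : p \in pars -> p' \in pars ->
    par_curve p = lm -> par_curve p' = lm ->
    (par_map p : gpts iota (fam lm) -> _) = par_map p' -> p = p'.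
Proof.
move=> p_par p'_par plm p'lm e.
have e' x y : on_cubic (map_cubic iota (fam lm)) (Some (x, y)) ->
    par_amap p (Some (x, y)) = par_amap p' (Some (x, y)).
  by move=> xy; have := congr1 (fun f => val (f (affpt xy))) e; rewrite /= !val_par_map.
have lm_ss : ss_model (fam lm).
  apply: (family_ss E_ss); rewrite -plm; apply: par_mu_neq0.
  by move: p_par; rewrite inE => /andP[].
have e1 x : exists y, par_amap p (Some (x, y)) = par_amap p' (Some (x, y)).
  have [y xy] := exists_on iota (a3 (fam lm)) (crhs (fam lm)) x.
  by exists y; apply: e'; rewrite on_cubicE.
case: p p' {e e' p_par p'_par plm p'lm} e1 => [u [r t]] [u' [r' t']] /= e1.
(* A point above x = 0 determines r and t, then one above x = 1 determines u. *)
have [y [er ey]] := e1 0; have [z [eu _]] := e1 1.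
move: er ey eu; rewrite !mulr0 !add0r !addr0 !mulr1 => /fmorph_inj->.
by move=> /addrI/fmorph_inj-> /addIr/fmorph_inj->.
Qed.

Lemma ec_isoV_comp C (f0 f : gpts iota C -> gpts iota E) (g0 : gpts iota E -> gpts iota C) :
    ss_model C -> ec_iso f0 -> cancel f0 g0 -> cancel g0 f0 -> ec_iso f ->
  ec_iso (f \o g0).
Proof.
move=> C_ss f0_iso fg gf f_iso; have g0_iso := ec_iso_inv f0_iso fg gf.
have [g0_aff _] := (ec_isoP g0 E_ss C_ss).1 g0_iso.
have [f_aff f_bij] := (ec_isoP f C_ss E_ss).1 f_iso.
apply/ec_isoP => //; split; first exact: affine_comp g0_aff f_aff.
by apply: bij_comp => //; exists f0.
Qed.

Lemma ec_iso_comp C (f : gpts iota C -> gpts iota E) (a : gpts iota E -> gpts iota E) :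
  ss_model C -> ec_iso f -> ec_iso a -> ec_iso (a \o f).
Proof.
move=> C_ss f_iso a_iso.
have [f_aff f_bij] := (ec_isoP f C_ss E_ss).1 f_iso.
have [a_aff a_bij] := (ec_isoP a E_ss E_ss).1 a_iso.
by apply/ec_isoP => //; split; [exact: affine_comp f_aff a_aff | exact: bij_comp].
Qed.

(** An automorphism is determined by five coefficients in the finite field [F]. *)
Lemma finite_ec_aut : finite_set (ec_aut iota E).
Proof.
pose h (z : F * F * F * F * F) (P : gpts iota E) : gpts iota E :=
  let: (u, v, r, s, t) := z in
  insubd (origin _) (amap (iota u) (iota v) (iota r) (iota s) (iota t) (val P)).
apply: (@sub_finite_set _ _ [set h z | z in [set: F * F * F * F * F]]); last first.
  exact/finite_image/finite_finset.
move=> f /(ec_isoP f E_ss E_ss).1[[u [v [r [s [t [_ _ fE]]]]]] _].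
by exists (u, v, r, s, t) => //; apply/funext => P; rewrite /h /= -fE valKd.
Qed.

(** For a fixed isomorphism [f0] with inverse [g0], sending p to [par_map p \o g0] is a bijection
    from the fiber to Aut(E). *)
Lemma card_fiber lm : lm.2 != 0 -> isomorphic iota (fam lm) E ->
  #|[set p in pars | par_curve p == lm]| = #|` fset_set (ec_aut iota E)|.
Proof.
move=> mu0 [f0 f0_iso]; have [_ _ [g0 [_ fg gf]]] := f0_iso.
have C_ss : ss_model (fam lm) by apply: (family_ss E_ss).
pose h p : gpts iota E -> gpts iota E := (par_map p : gpts iota (fam lm) -> _) \o g0.
pose A := [set p in pars | par_curve p == lm]%SET.
have AP p : reflect (p \in pars /\ par_curve p = lm) (p \in A).
  by rewrite [p \in A]finset.in_set; apply: (iffP andP) => -[? /eqP].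
have -> : ec_aut iota E = [set` [fset h p | p in A]%fset]%classic.
  apply/seteqP; split=> [a a_iso|a /= /imfsetP[p /= /AP[p_par plm] ->]].
    have [p [p_par plm e]] := par_map_onto mu0 (ec_iso_comp C_ss f0_iso a_iso).
    apply/imfsetP; exists p; first exact/AP.
    by apply/funext => Q; rewrite /h -e /= gf.
  apply: (ec_isoV_comp C_ss f0_iso fg gf).
  by have := par_map_iso p_par; rewrite plm.
rewrite set_fsetK card_in_imfset /=; first by rewrite cardE.
move=> p p' /AP[p_par plm] /AP[p'_par p'lm] e; apply: par_map_inj plm p'lm _ => //.
by apply/funext => P; rewrite -(fg P); exact: (congr1 (fun f => f (f0 P)) e).
Qed.

(** The first predecessor removes u = 0, the second the point at infinity, which [pts E]
    contains. *)
Lemma card_pars : #|pars| = ((#|F|).-1 * (#|{: pts E}|).-1)%N.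
Proof.
have -> : pars = finset.setX [set~ 0]%SET [set P | on_cubic E (Some P)]%SET.
  by apply/setP => -[u P]; rewrite !inE.
rewrite cardsX cardsC1; congr (_ * _)%N.
rewrite card_sig (cardD1 None) -[None \in _]/true add1n succnK.
rewrite -(fintype.card_image (@Some_inj _)).
apply: eq_card => -[P|]; first by rewrite fintype.mem_image ?inE; last exact: Some_inj.
by apply/fintype.imageP => -[].
Qed.

(** The fibers of [par_curve] partition the parameters, and each one above an isomorphic member has
    as many elements as Aut(E). *)
Lemma count_isomorphic :
  muln #|[set lm : F * F | (lm.2 != 0) && `[< isomorphic iota (fam lm) E >]]|
    #|` fset_set (ec_aut iota E)| = #|pars|.
Proof.
set N := [set lm | _]%SET.
have NP p : p \in pars -> par_curve p \in N.
  move=> p_par; rewrite finset.in_set; apply/andP; split.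
    by move: p_par; rewrite inE => /andP[p0 _]; apply: par_mu_neq0.
  by apply/asboolP; eexists; apply: par_map_iso p_par.
rewrite -[RHS]sum1_card (partition_big _ _ NP) /= -sum_nat_const.
apply: eq_bigr => lm; rewrite finset.in_set => /andP[mu0 /asboolP lm_iso].
by rewrite -(card_fiber mu0 lm_iso) sum1dep_card.
Qed.

End Isomorphisms.

Theorem proposition4p2
  (q m : nat) (m_gt0 : (0 < m)%N) (q_def : q = (2 ^ m)%N) (q_gt4 : (4 < q)%N)
  (F : finFieldType) (cardF : #|F| = q)
  (K : closedFieldType) (iota : {rmorphism F -> K})
  (K_alg : integralRange iota)
  (E : cubic F) (E_ell : elliptic iota E) (E_ss : supersingular iota E) :
  finite_set (ec_aut iota E) /\
  #|[set lm : F * F | (lm.2 != 0)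
                      && `[< isomorphic iota (family_curve lm.1 lm.2) E >]]|%:R
    = (q%:R - 1) * (#|{: pts E}|%:R - 1) / #|` fset_set (ec_aut iota E)|%:R :> rat.
Proof.
have char2 : 2%N \in [pchar F] by apply: (card_finPcharP (n := m)); rewrite ?cardF.
have E_model := ss_model_supersingular char2 E_ell E_ss.
(* The square root of w is w^(q/2), since w^q = w. *)
have sqrtK (w : F) : (w ^+ (2 ^ m.-1)) ^+ 2 = w.
  by rewrite -exprM -expnSr prednK // -q_def -cardF expf_card.
have fin_aut := finite_ec_aut iota E_model.
split=> //.
(* The identity is an automorphism, so the divisor is nonzero. *)
have aut_gt0 : (0 < #|` fset_set (ec_aut iota E)|)%N.
  rewrite cardfs_gt0; apply/fset0Pn; exists id; rewrite in_fset_set // inE.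
  apply/(ec_isoP _ E_model E_model); split; last by exists id.
  exists 1, 1, 0, 0, 0; split; rewrite ?oner_neq0 // => P.
  by rewrite rmorph1 rmorph0; case: (val P) => [[x y]|//] /=; rewrite !mul1r mul0r !addr0.
have := count_isomorphic iota E_model sqrtK; rewrite card_pars cardF.
move=> /(congr1 (fun n => n%:R : rat)); rewrite !natrM => e.
have pts_gt0 : (0 < #|{: pts E}|)%N by apply/card_gt0P; exists (origin E).
have predE n : (0 < n)%N -> n%:R - 1 = n.-1%:R :> rat.
  by move=> n0; rewrite -subn1 natrB.
rewrite !predE //; last by rewrite (leq_trans _ q_gt4).
by rewrite -e mulfK // Num.Theory.pnatr_eq0 -lt0n.
Qed.
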